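(* Let $p\ge1$ and $s\in(0,1]$ be fixed, and let $q\in(0,\infty)$. There exists a constant $C>0$ depending only on $s,p,d,q$ such that, for every $f\in L^p_{\mathrm{loc}}(\mathbb{R}^d)$ and every positive function $g\in L^p(\mathbb{R}^d)$ satisfying $$|f(x)-f(y)|\le |x-y|^s\big(\exp\{g(x)+g(y)\}-1\big)\qquad\text{for all }x,y\in\mathbb{R}^d,$$ one has $$\int_{B_{1/3}}\int_{\mathbb{R}^d}\frac{\min\{1,|f(x+h)-f(x)|^q\}}{|h|^d}\,\frac{1}{[\log(1/|h|)]^{1-p}}\,dx\,dh\le C\big(\|g\|_{L^p}^p+\|g\|_{L^q}^q\big).$$ In particular, there is the continuous immersion $$N^{s,p}\cap L^\infty(\mathbb{R}^d)\hookrightarrow X^{1,p}$$ for any $s\in(0,1]$ and $p\ge1$.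
   Context: $d\ge1$ and $B_r$ is the Euclidean ball of radius $r$ centered at the origin of $\mathbb{R}^d$. $N^{s,p}$ is the set of $f\in L^p_{\mathrm{loc}}(\mathbb{R}^d)$ for which there exists a positive function $g\in L^p(\mathbb{R}^d)$ with $|f(x)-f(y)|\le|x-y|^s(\exp\{g(x)+g(y)\}-1)$ for all $x,y\in\mathbb{R}^d$; $[f]_{N^{s,p}}$ denotes the infimum of $\|g\|_{L^p}$ over all such $g$ (in general not a semi-norm). Further, $$[f]_{X^{1,p}}:=\left(\int_{B_{1/3}}\int_{\mathbb{R}^d}\frac{|f(x+h)-f(x)|^p}{|h|^d}\,\frac{1}{[\log(1/|h|)]^{1-p}}\,dx\,dh\right)^{1/p},$$ and $X^{1,p}:=\{f\in L^p(\mathbb{R}^d):[f]_{X^{1,p}}<\infty\}$ with $\|f\|_{X^{1,p}}^p:=\|f\|_{L^p}^p+[f]_{X^{1,p}}^p$.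
   Formalization: The immersion fails as stated (f=1 is in N^{s,p}∩L^∞ but not in L^p); it is proved instead for N^{s,p}∩L^∞ into {[f]_{X^{1,p}}<∞} with [·]_{X^{1,p}}, and for N^{s,p}∩L^∞∩L^p, with the L^p norm added to the distance, into X^{1,p} with its full norm. *)

(* Defs.v *)
From HB Require Import structures.
From mathcomp Require Import all_boot all_order all_algebra.
From mathcomp Require Import all_classical all_reals all_analysis.

Set Implicit Arguments.
Unset Strict Implicit.
Unset Printing Implicit Defensive.

Import Order.TTheory GRing.Theory Num.Theory.
Import numFieldNormedType.Exports.

Local Open Scope classical_set_scope.
Local Open Scope ring_scope.

Definition rV_display : measure_display -> measure_display.
Proof. exact. Qed.

Section measurable_rV.
Context (R : realType) (n : nat).

Let coord : 'I_n -> 'rV[R]_n -> measurableTypeR R := fun i x => x ord0 i.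

Let rV_set0 : g_sigma_preimage coord set0.
Proof. exact: sigma_algebra0. Qed.

Let rV_setC A : g_sigma_preimage coord A -> g_sigma_preimage coord (~` A).
Proof. exact: sigma_algebraC. Qed.

Let rV_bigcup (F : (set 'rV[R]_n)^nat) :
  (forall i, g_sigma_preimage coord (F i)) ->
  g_sigma_preimage coord (\bigcup_i (F i)).
Proof. exact: sigma_algebra_bigcup. Qed.

(* the product of the Borel sigma-algebras, as the library does on tuples *)
HB.instance Definition _ := @isMeasurable.Build
  (rV_display default_measure_display) 'rV[R]_n
  (g_sigma_preimage coord) rV_set0 rV_setC rV_bigcup.

End measurable_rV.

Lemma measurable_rV_coord (R : realType) n (i : 'I_n) :
  measurable_fun [set: 'rV[R]_n] (fun x => x ord0 i : measurableTypeR R).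
Proof.
move=> _ Y mY; rewrite setTI; apply: sub_sigma_algebra => /=.
rewrite -bigcup_seq/=; exists i => /=; first by rewrite mem_index_enum.
by exists Y => //; rewrite setTI.
Qed.

Lemma measurable_fun_rVP d (T : measurableType d) (R : realType) n
    (f : T -> 'rV[R]_n) :
  (forall i, measurable_fun [set: T] (fun x => f x ord0 i : measurableTypeR R)) ->
  measurable_fun [set: T] f.
Proof.
move=> mf.
suff : g_sigma_preimage (fun i x => f x ord0 i : measurableTypeR R)
    `<=` measurable.
  move=> prefS _ A mA; apply: prefS.
  rewrite (g_sigma_preimage_comp
    (fun i (x : 'rV[R]_n) => x ord0 i : measurableTypeR R) f).
  by exists A.
apply: smallest_sub; first exact: sigma_algebra_measurable.
case: n => [|n] in f mf *; first by rewrite big_ord0.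
rewrite -bigcup_mkord_ord; apply: bigcup_sub => i Ii.
by move=> A [B mB <-]; exact: mf.
Qed.

Section lebesgue_measure_rV.
Context (R : realType).

Definition rV_cons n (z : 'rV[R]_n * measurableTypeR R) : 'rV[R]_n.+1 :=
  row_mx (z.2 : R)%:M z.1.

Lemma measurable_rV_cons n : measurable_fun [set: _] (@rV_cons n).
Proof.
apply: measurable_fun_rVP => i; rewrite /rV_cons.
case: (@split_ordP 1 n i) => j ->.
  apply: (eq_measurable_fun snd) => [z _|]; last exact: measurable_snd.
  rewrite -[LHS]mulr1n; apply/esym/(etrans (row_mxEl (z.2 : R)%:M z.1 ord0 j)).
  by rewrite [j]ord1 mxE.
apply: (eq_measurable_fun
    ((fun x : 'rV[R]_n => x ord0 j : measurableTypeR R) \o fst)) => [z _|].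
  exact/esym/(row_mxEr (z.2 : R)%:M z.1 ord0 j).
apply: (measurableT_comp _ measurable_fst); exact: measurable_rV_coord.
Qed.

Definition lebesgue_cons n (mu : {measure set 'rV[R]_n -> \bar R}) :
  {measure set 'rV[R]_n.+1 -> \bar R}.
Proof.
refine (pushforward (mu \x @lebesgue_measure R)%E (@rV_cons n)).
exact: measurable_rV_cons.
Defined.

(* the product of n copies of the Lebesgue measure on the line *)
Fixpoint lebesgue_rV n : {measure set 'rV[R]_n -> \bar R} :=
  if n is m.+1 then lebesgue_cons (lebesgue_rV m) else dirac (0 : 'rV[R]_0).

End lebesgue_measure_rV.
Arguments lebesgue_rV {R} n.

Section function_spaces.
Context (R : realType) (d : nat).
Local Notation E := 'rV[R]_d.
Local Notation mu := (@lebesgue_rV R d).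
Implicit Types (f g : E -> R) (p q s r : R).

(* the norm `|x| of the library on 'rV[R]_d is the sup norm *)
Definition enorm (x : E) : R := Num.sqrt (\sum_(i < d) x ord0 i ^+ 2).

Definition eball r : set E := [set x | enorm x < r].

(* Measurability for the completion of the Borel sigma-algebra. The integral of
   a nonnegative function is a supremum over Borel simple functions, hence has
   its usual value on these functions. *)
Definition lebesgue_measurable f : Prop :=
  exists2 f', measurable_fun [set: E] f' & {ae mu, forall x, f x = f' x}.

Definition Lp (p : \bar R) : set (E -> R) :=
  [set f | lebesgue_measurable f /\ finite_norm mu p f].

Definition Lp_loc p : set (E -> R) :=
  [set f | lebesgue_measurable f /\
    forall K : set E, compact K -> (\int[mu]_(x in K) (`|f x| `^ p)%:E < +oo)%E].

Definition N_ineq s f g : Prop :=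
  forall x y, `|f x - f y| <= enorm (x - y) `^ s * (expR (g x + g y) - 1).

Definition N_admissible s p f g : Prop :=
  [/\ forall x, 0 < g x, Lp p%:E g & N_ineq s f g].

Definition N_space s p : set (E -> R) :=
  [set f | Lp_loc p f /\ exists g, N_admissible s p f g].

(* equal to +oo when there is no admissible g *)
Definition N_func s p f : \bar R :=
  ereal_inf [set 'N[mu]_(p%:E)[EFin \o g] | g in N_admissible s p f]%E.

Definition log_weight p (h : E) : R := 1 / ln (1 / enorm h) `^ (1 - p).

Definition X_func p f : \bar R :=
  ((\int[mu]_(h in eball (1 / 3)) \int[mu]_x
      (`|f (x + h) - f x| `^ p / enorm h ^+ d * log_weight p h)%:E)
    `^ p^-1)%E.

(* Nonzero constant functions belong to N_space and are bounded, and X_func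
   vanishes on them, but they are not in Lp p, hence not in X_space. *)
Definition X_space p : set (E -> R) :=
  [set f | Lp p%:E f /\ (X_func p f < +oo)%E].

Definition X_norm p f : \bar R :=
  (('N[mu]_(p%:E)[EFin \o f] `^ p + X_func p f `^ p) `^ p^-1)%E.

(* V is included in W, and the inclusion is continuous for the distances
   nV (f - f') and nW (f - f') and maps nV-bounded sets to nW-bounded sets.
   When nV is not homogeneous, neither of the last two properties
   is a formal consequence of the other. *)
Definition continuous_immersion (V : set (E -> R)) (nV : (E -> R) -> \bar R)
    (W : set (E -> R)) (nW : (E -> R) -> \bar R) : Prop :=
  [/\ V `<=` W,
      forall f0, V f0 -> forall e : R, 0 < e -> exists2 delta : R, 0 < delta &
        forall f, V f -> (nV (f \- f0)%R < delta%:E)%E -> (nW (f \- f0)%R < e%:E)%E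
    & forall A : R, exists B : R,
        forall f, V f -> (nV f <= A%:E)%E -> (nW f <= B%:E)%E].

End function_spaces.

(* Main.v *)
(* Cut the ball of radius 1/3 < 1/e into the shells k+1 <= log (1/|h|) < k+2. On
   the k-th shell the weight times |h|^-d is at most e^(d(k+2)) (k+2)^(p-1), while
   the shell has measure at most (2 e^-(k+1))^d, so the powers of e cancel. There,
   min (1, |f(x+h) - f(x)|^q) <= theta_k (g x) + theta_k (g (x + h)) where
   theta_k y = 1_(y >= s(k+1)/4) + 2^q e^-(sq(k+1)/2) y^q. By translation invariance
   both terms have the same integral in x, and the sum over k of
   (k+2)^(p-1) theta_k y is at most C (y^p + y^q): the indicator vanishes for
   k+1 > 4y/s. For bounded f, |f(x+h) - f(x)|^p is at most a constant times its
   truncation, and the case q = p gives the immersions.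

   The integrands need not be Borel, since f and g are only a.e. equal to Borel
   functions; integrals of nonnegative functions are lower integrals, for which
   only a.e. monotonicity and the bound for a positive factor are used. *)

Require Import Defs.
From HB Require Import structures.
From mathcomp Require Import all_boot all_order all_algebra.
From mathcomp Require Import ring lra.
From mathcomp Require Import all_classical all_reals all_analysis.
From mathcomp Require Import measurable_realfun ess_sup_inf.

Set Implicit Arguments.
Unset Strict Implicit.
Unset Printing Implicit Defensive.

Import Order.TTheory GRing.Theory Num.Theory.
Import numFieldNormedType.Exports.

Local Open Scope classical_set_scope.
Local Open Scope ring_scope.

(** * Integrals of nonnegative functions without measurability assumptions *)

Section lower_integral.
Context d (T : measurableType d) (R : realType).
Variable mu : {measure set T -> \bar R}.
Import HBNNSimple.

(** A simple function below [f1], cut off by the indicator of the complement of a Borel null set, is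
    still simple, keeps its integral and lies below [f2]. *)
Lemma ae_ge0_le_lower_integral (f1 f2 : T -> \bar R) :
  (forall x, 0 <= f1 x)%E -> (forall x, 0 <= f2 x)%E ->
  {ae mu, forall x, (f1 x <= f2 x)%E} ->
  (\int[mu]_x f1 x <= \int[mu]_x f2 x)%E.
Proof.
move=> f10 f20 [N [mN N0 fN]].
rewrite (ge0_integralTE mu f10); apply: ge_ereal_sup => _ [h /= hf1 <-].
rewrite -integralT_nnsfun (@ge0_negligible_integral _ _ _ mu setT N)//; last 2 first.
- exact/measurable_EFinP.
- by move=> x _; rewrite lee_fin.
rewrite setTD integral_mkcond.
have mh : measurable_fun setT ((EFin \o h) \_ (~` N)).
  apply/(measurable_restrictT _ (measurableC mN)).
  exact/measurable_funTS/measurable_EFinP.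
pose h' := h \* indic_nnsfun R (measurableC mN).
have h'E : (fun x => (h' x)%:E) = ((EFin \o h) \_ (~` N)).
apply/funext => x; rewrite /h' patchE /= /mindic indicE.
  by case: (x \in ~` N); rewrite ?mulr1 ?mulr0.
rewrite (eq_integral (fun x => (h' x)%:E)); last by move=> x _; rewrite -h'E.
rewrite integralT_nnsfun (ge0_integralTE mu f20).
apply: ereal_sup_ubound; exists h' => //= x.
have := congr1 (fun u => u x) h'E; rewrite /= => ->; rewrite patchE.
case: ifPn => // /set_mem xN; apply: le_trans (hf1 x) _.
by apply: contrapT => /fN.
Qed.

Lemma ge0_le_lower_integral (D : set T) (f1 f2 : T -> \bar R) :
  (forall x, 0 <= f1 x)%E -> (forall x, 0 <= f2 x)%E ->
  (forall x, D x -> (f1 x <= f2 x)%E) ->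
  (\int[mu]_(x in D) f1 x <= \int[mu]_x f2 x)%E.
Proof.
move=> f10 f20 f12; rewrite integral_mkcond.
apply: ae_ge0_le_lower_integral => //.
  by move=> x; rewrite patchE; case: ifP.
apply: nearW => x; rewrite patchE; case: ifPn => // /set_mem; exact: f12.
Qed.

(** Dividing by [k] a simple function below [k * f] gives a measurable function below [f]; linearity
    is applied to that function alone. *)
Lemma ge0_lower_integralZl_le (D : set T) (f : T -> \bar R) (k : R) : 0 < k ->
  (forall x, 0 <= f x)%E ->
  (\int[mu]_(x in D) (k%:E * f x) <= k%:E * \int[mu]_(x in D) f x)%E.
Proof.
move=> k0 f0; rewrite integral_mkcond [in leRHS]integral_mkcond erestrict_scale.
set u := f \_ D.
have u0 x : (0 <= u x)%E by rewrite /u patchE; case: ifP.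
have ku0 x : (0 <= k%:E * u x)%E by rewrite mule_ge0// lee_fin ltW.
rewrite (ge0_integralTE mu ku0); apply: ge_ereal_sup => _ [h /= hu <-].
rewrite -integralT_nnsfun.
rewrite (eq_integral (fun x => (k%:E * (k^-1 * h x)%:E)%E)); last first.
  by move=> x _; rewrite -EFinM mulVKf// gt_eqF.
have h0 x : (0 <= (k^-1 * h x)%:E)%E by rewrite lee_fin mulr_ge0// invr_ge0 ltW.
rewrite ge0_integralZl_EFin//; last exact: ltW; last first.
  by apply/measurable_EFinP; exact: measurable_funM.
apply: lee_wpmul2l; first by rewrite lee_fin ltW.
apply: ae_ge0_le_lower_integral => //; apply: nearW => x.
rewrite EFinM -(@lee_pmul2l _ k%:E) ?lte_fin//.
by rewrite muleA -EFinM mulfV ?gt_eqF// mul1r; exact: hu.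
Qed.
End lower_integral.

(** * Translation invariance of the Lebesgue measure and volumes of cubes *)

Lemma ge0_integral_preserving d (T : measurableType d) (R : realType)
    (mu : {measure set T -> \bar R}) (tau : T -> T) (phi : T -> \bar R) :
  measurable_fun setT tau ->
  (forall A, measurable A -> mu (tau @^-1` A) = mu A) ->
  measurable_fun setT phi -> (forall x, 0 <= phi x)%E ->
  (\int[mu]_x phi (tau x) = \int[mu]_x phi x)%E.
Proof.
move=> mtau tau_mu mphi phi0.
pose m : {measure set T -> \bar R} := pushforward mu tau.
transitivity (\int[m mtau]_x phi x)%E.
  by apply/esym; rewrite [LHS]ge0_integral_pushforward.
by apply: eq_measure_integral => A mA _; exact: tau_mu.
Qed.

Section lebesgue_translation.
Context (R : realType).

(** The translated measure agrees with the Lebesgue measure on half-open intervals, and these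
    determine it. *)
Lemma lebesgue_measure_translation (c : R) (A : set (measurableTypeR R)) :
  measurable A ->
  (@lebesgue_measure R) ((fun t => t + c) @^-1` A) = lebesgue_measure A.
Proof.
move=> mA.
have mc : measurable_fun setT
    (fun t : measurableTypeR R => (t + c : measurableTypeR R)).
  exact: measurable_funD.
pose m : {measure set (measurableTypeR R) -> \bar R} :=
  pushforward (@lebesgue_measure R)
    (fun t : measurableTypeR R => (t + c : measurableTypeR R)).
suff mE X : ocitv X -> (@lebesgue_measure R) X = m mc X.
  by rewrite (lebesgue_measure_unique mE mA).
move=> [[a b] _ <-] /=.
rewrite /m/= /pushforward.
have -> : ((fun t : measurableTypeR R => (t + c : measurableTypeR R))
    @^-1` `]a, b]) = `]a - c, b - c]%classic.
  by apply/seteqP; split => x /=; rewrite !in_itv/= ltrBlDr lerBrDr.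
rewrite !lebesgue_measure_itv/= !lte_fin ltrD2r; case: ifP => // _.
by rewrite -!EFinD; congr (_%:E); ring.
Qed.

Lemma measurable_rV_translation n (c : 'rV[R]_n) :
  measurable_fun setT (fun x : 'rV[R]_n => x + c).
Proof.
apply: measurable_fun_rVP => i.
apply: (eq_measurable_fun (fun x : 'rV[R]_n => x ord0 i + c ord0 i)).
  by move=> x _; rewrite mxE.
by apply: measurable_funD => //; exact: measurable_rV_coord.
Qed.

Definition rV_tail n (x : 'rV[R]_n.+1) : 'rV[R]_n := rsubmx (x : 'rV_(1 + n)).

Lemma rV_cons_translation n (c : 'rV[R]_n.+1) (z : 'rV[R]_n * measurableTypeR R) :
  rV_cons z + c = rV_cons (z.1 + rV_tail c, z.2 + c ord0 ord0).
Proof.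
apply/rowP => i; rewrite mxE /rV_cons.
case: (@split_ordP 1 n i) => j ->.
  rewrite !(@row_mxEl _ 1 1 n) [j]ord1 !mxE /= !mulr1n; congr (_ + c _ _).
  exact/val_inj.
by rewrite !(@row_mxEr _ 1 1 n) !mxE.
Qed.

(** Induction on the dimension by slicing: the one-dimensional case preserves the length of each
    slice, and the induction hypothesis preserves the integral of these lengths over the remaining
    coordinates. *)
Lemma lebesgue_rV_translation n (c : 'rV[R]_n) (A : set 'rV[R]_n) :
  measurable A -> lebesgue_rV n ((fun x => x + c) @^-1` A) = lebesgue_rV n A.
Proof.
elim: n c A => [|n ih] c A mA.
  by congr (lebesgue_rV 0 _); apply/seteqP; split=> x;
    rewrite /preimage/= [c](_ : _ = 0) ?addr0//; apply/rowP => -[].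
rewrite /= /pushforward.
pose B := @rV_cons R n @^-1` A.
have mB : measurable B.
  by rewrite -[B]setTI; exact: measurable_rV_cons.
rewrite -[RHS]/((lebesgue_rV n \x @lebesgue_measure R)%E B).
rewrite /= /product_measure1/=.
have mphi := measurable_fun_xsection (@lebesgue_measure R) mB.
set phi := (X in measurable_fun _ X) in mphi.
rewrite [RHS](_ : _ = \int[lebesgue_rV n]_x phi x)%E//.
rewrite -(ge0_integral_preserving (measurable_rV_translation (rV_tail c))
  (ih _) mphi)//.
apply: eq_integral => x _ /=.
rewrite /phi/=; rewrite -[RHS](@lebesgue_measure_translation (c ord0 ord0));
  last exact: measurable_xsection.
congr (lebesgue_measure _); apply/seteqP; split => t;
  by rewrite /xsection/= !inE/= /B/= rV_cons_translation.
Qed.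

Lemma integral_rV_translation n (c : 'rV[R]_n) (phi : 'rV[R]_n -> \bar R) :
  measurable_fun setT phi -> (forall x, 0 <= phi x)%E ->
  (\int[lebesgue_rV n]_x phi (x + c)%R = \int[lebesgue_rV n]_x phi x)%E.
Proof.
by apply: ge0_integral_preserving => [|A]; [exact: measurable_rV_translation|
  exact: lebesgue_rV_translation].
Qed.

Definition box n (r : R) : set 'rV[R]_n := [set x | forall i, `|x ord0 i| <= r].

Lemma measurable_box n (r : R) : measurable (@box n r).
Proof.
have -> : @box n r = \big[setI/setT]_(i < n)
    ((fun x : 'rV[R]_n => x ord0 i : measurableTypeR R) @^-1` `[- r, r]).
  rewrite -bigcap_seq; apply/seteqP; split => x /=.
    by move=> xr i _ /=; rewrite in_itv/= -ler_norml.
  by move=> xr i; have /= := xr i (mem_index_enum _); rewrite in_itv/= -ler_norml.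
apply: bigsetI_measurable => i _; rewrite -[X in measurable X]setTI.
exact: measurable_rV_coord.
Qed.

Lemma lebesgue_rV_box n (r : R) : 0 <= r ->
  lebesgue_rV n (@box n r) = ((r *+ 2) ^+ n)%:E.
Proof.
move=> r0; elim: n => [|n ih].
  rewrite /= diracE mem_set ?expr0// => -[]//.
rewrite /= /pushforward.
have -> : @rV_cons R n @^-1` (@box n.+1 r) = @box n r `*` `[- r, r]%classic.
  apply/seteqP; split => -[x t] /=; rewrite in_itv/= -ler_norml.
    move=> H; split => [i|].
      by have := H (rshift 1 i); rewrite (@row_mxEr _ 1 1 n).
    by have := H (lshift n (ord0 : 'I_1)); rewrite (@row_mxEl _ 1 1 n) !mxE mulr1n.
  move=> [H1 H2] i; case: (@split_ordP 1 n i) => j ->.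
    by rewrite (@row_mxEl _ 1 1 n) [j]ord1 !mxE mulr1n.
  by rewrite (@row_mxEr _ 1 1 n).
rewrite product_measure1E//; last exact: measurable_box.
rewrite [lebesgue_rV n _]ih.
rewrite [X in (_ * X)%E](lebesgue_measure_itv `[- r, r]) /= lte_fin.
have [r1|r1] := ltP.
  by rewrite -EFinD opprK -EFinM exprSr mulr2n.
(* The length formula distinguishes whether [- r < r]; since [0 <= r], the degenerate case is
   [r = 0]. *)
have -> : r = 0 by lra.
by rewrite mule0 mul0rn exprS mul0r.
Qed.

End lebesgue_translation.

(** * Pointwise bounds and their summation over the shells *)

Section real_estimates.
Context (R : realType).
Implicit Types p q s c x y : R.

Let eqW x y : x = y -> x <= y.
Proof. by move->. Qed.

(** This is [1 - x <= exp (- x)] multiplied by [exp x]. The factor [x] on the right makes the bound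
    on the difference linear in [g]. *)
Lemma expR_sub1_le x : expR x - 1 <= x * expR x.
Proof.
have := expR_ge1Dx (- x); rewrite expRN => H.
have e0 := expR_gt0 x.
have : (1 + - x) * expR x <= 1.
  by rewrite -[leRHS](mulVf (lt0r_neq0 e0)) ler_pM2r.
by rewrite mulrDl mul1r mulNr; lra.
Qed.

(** The inequality [t <= exp t] at [t = c * x / p], raised to the power [p]. It trades the
    polynomial weight for a part of the exponential decay. *)
Lemma powR_le_expR p c x : 0 < p -> 0 < c -> 0 <= x ->
  x `^ p <= (p / c) `^ p * expR (c * x).
Proof.
move=> p0 c0 x0; have p0' := ltW p0; have c0' := ltW c0.
have -> : x = (p / c) * (c * x / p) by field; rewrite !gt_eqF.
have cx0 : 0 <= c * x / p by rewrite divr_ge0 ?mulr_ge0.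
rewrite powRM//; last exact: divr_ge0.
rewrite ler_wpM2l ?powR_ge0//.
have : c * x / p <= expR (c * x / p).
  by apply: le_trans (expR_ge1Dx _); rewrite lerDr.
move/(ge0_ler_powR (ltW p0)) => /(_ _ _)/le_trans; apply;
  rewrite ?nnegrE// ?expR_ge0//.
rewrite -expRM ler_expR; apply: eqW.
by field; rewrite !gt_eqF.
Qed.

(* If |h| lies between e^-(k+2) and e^-(k+1), either one of the two values of g is
   at least s(k+1)/4 and the difference is truncated by 1, or
   |h|^s (exp (g x + g (x + h)) - 1) <= 2 e^-(s(k+1)/2) max (g x) (g (x + h)). *)
Definition shell_majorant s q (k : nat) y : R :=
  (s * k.+1%:R / 4 <= y)%R%:R + 2 `^ q * expR (- (k.+1%:R * s * q / 2)) * y `^ q.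

Lemma shell_majorant_ge0 s q k y : 0 <= shell_majorant s q k y.
Proof. by rewrite addr_ge0// ?mulr_ge0 ?powR_ge0 ?expR_ge0. Qed.

Lemma measurable_shell_majorant s q k : measurable_fun setT (shell_majorant s q k).
Proof.
apply: measurable_funD; last first.
  by apply: measurable_funM => //; exact: measurable_powR.
apply: (eq_measurable_fun (\1_`[s * k.+1%:R / 4, +oo[ : R -> R)).
  move=> y _; rewrite indicE; congr ((_ : bool)%:R); apply/idP/idP.
    by move/set_mem; rewrite /= in_itv/= andbT.
  by move=> H; apply/mem_set; rewrite /= in_itv/= andbT.
by apply: measurable_indic; exact: measurable_itv.
Qed.

Lemma min_powR_le_shell_majorant s q t k a b D : 0 < s -> 0 < q -> 0 < t ->
  k.+1%:R <= ln (1 / t) -> 0 <= a -> 0 <= b -> 0 <= D ->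
  D <= t `^ s * (expR (a + b) - 1) ->
  Num.min 1 (D `^ q) <= shell_majorant s q k a + shell_majorant s q k b.
Proof.
wlog ab : a b / a <= b.
  move=> H *; case: (leP a b) => [|/ltW] ab; first exact: H.
  by rewrite [leRHS]addrC; apply: (H b a) => //; rewrite [b + a]addrC.
move=> s0 q0 t0 kt a0 b0 D0 Dle.
apply: le_trans (_ : shell_majorant s q k b <= _); last first.
  by rewrite lerDr shell_majorant_ge0.
have [bk|bk] := leP (s * k.+1%:R / 4) b.
  rewrite ge_min; apply/orP; left; rewrite /shell_majorant bk lerDl.
  by rewrite ?mulr_ge0 ?powR_ge0 ?expR_ge0.
rewrite ge_min; apply/orP; right; rewrite /shell_majorant (lt_geF bk)/= add0r.
have {}Dle : D <= 2 * (expR (- (k.+1%:R * s / 2))) * b.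
  apply: (le_trans Dle).
  have ts : t `^ s <= expR (- (k.+1%:R * s)).
    rewrite /powR gt_eqF// ler_expR.
    rewrite div1r lnV ?posrE// in kt.
    by rewrite mulrC -mulNr ler_pM2r// lerNr.
  (* Here [a + b <= 2 * b < s * (k + 1) / 2], so the exponential consumes only half of the decay of
     [t ^ s]. *)
  have e1 : expR (a + b) - 1 <= (2 * b) * expR (k.+1%:R * s / 2).
    apply: (@le_trans _ _ (expR (2 * b) - 1)).
      by rewrite lerD2r ler_expR; lra.
    apply: (le_trans (expR_sub1_le _)).
    rewrite ler_wpM2l ?mulr_ge0// ler_expR; lra.
  apply: (@le_trans _ _ (expR (- (k.+1%:R * s)) *
    ((2 * b) * expR (k.+1%:R * s / 2)))).
    apply: ler_pM => //; first exact: powR_ge0.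
    by rewrite subr_ge0 -expR0 ler_expR addr_ge0.
  have -> : - (k.+1%:R * s) = - (k.+1%:R * s / 2) - (k.+1%:R * s / 2) by field.
  rewrite expRD expRN; have := expR_gt0 (k.+1%:R * s / 2) => e0.
  apply: eqW; field; by rewrite gt_eqF.
apply: (@le_trans _ _ ((2 * (expR (- (k.+1%:R * s / 2))) * b) `^ q)).
  by apply: (ge0_ler_powR (ltW q0)); rewrite ?nnegrE// ?mulr_ge0 ?expR_ge0.
rewrite !powRM ?mulr_ge0 ?expR_ge0// -expRM.
by apply: eqW; congr (_ * expR _ * _); field.
Qed.

Lemma sum_indic_le n x : 0 <= x -> \sum_(k < n) (k.+1%:R <= x)%R%:R <= x.
Proof.
(* The trivial bound by [n] joins the induction: when [n + 1 <= x], it controls the sum including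
   its new last term. *)
move=> x0; suff : \sum_(k < n) (k.+1%:R <= x)%R%:R <= x /\
  \sum_(k < n) ((k.+1%:R <= x)%R%:R : R) <= n%:R by case.
elim: n => [|n [ih1 ih2]]; first by rewrite big_ord0.
rewrite !big_ord_recr/=; case: (leP n.+1%:R x) => nx/=; last first.
  by rewrite addr0; split=> //; apply: (le_trans ih2); rewrite ler_nat.
have H : \sum_(k < n) ((k.+1%:R <= x)%R%:R : R) + 1 <= n.+1%:R.
  by rewrite -natr1 lerD2r.
by split => //; exact: le_trans nx.
Qed.

(** At most [4 * y / s] of the indicators survive, each with weight at most [(8 * y / s) ^ (p - 1)].
    In the other part the exponential absorbs the weight and a geometric series remains. *)
Lemma sum_shell_majorant_le p s q : 1 <= p -> 0 < s -> 0 < q ->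
  exists2 C : R, 0 < C & forall n y, 0 <= y ->
    \sum_(k < n) k.+2%:R `^ (p - 1) * shell_majorant s q k y
      <= C * (y `^ p + y `^ q).
Proof.
move=> p1 s0 q0.
have p0 : 0 < p by exact: lt_le_trans p1.
(* With this [c] the decay is [exp (- 4 * c * (k + 1))]. Absorbing the weight costs
   [exp (c * (k + 2))], and what remains is at most [r ^ k] with [r = exp (- 2 * c)]. *)
pose c := s * q / 8.
have c0 : 0 < c by rewrite divr_gt0 ?mulr_gt0.
pose r := expR (- (2 * c)).
have r01 : 0 < r < 1 by rewrite expR_gt0/= expR_lt1 oppr_lt0 mulr_gt0.
have /andP[r0 r1] := r01.
pose C1 := (8 / s) `^ (p - 1) * (4 / s).
pose C2 := 2 `^ q * ((p / c) `^ p) / (1 - r).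
have C10 : 0 <= C1 by rewrite mulr_ge0 ?powR_ge0// divr_ge0// ltW.
have C20 : 0 <= C2 by rewrite divr_ge0 ?mulr_ge0 ?powR_ge0// subr_ge0 ltW.
exists (C1 + C2 + 1); first by rewrite ltr_wpDl ?addr_ge0.
move=> n y y0.
have yp0 := powR_ge0 y p; have yq0 := powR_ge0 y q.
suff [H1 H2] :
    \sum_(k < n) k.+2%:R `^ (p - 1) * (s * k.+1%:R / 4 <= y)%R%:R
      <= C1 * y `^ p /\
    \sum_(k < n) k.+2%:R `^ (p - 1) *
        (2 `^ q * expR (- (k.+1%:R * s * q / 2)) * y `^ q) <= C2 * y `^ q.
  under eq_bigr do rewrite /shell_majorant mulrDr.
  rewrite big_split/=; apply: (le_trans (lerD H1 H2)); nra.
split.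
- pose x := 4 * y / s.
  have x0 : 0 <= x by rewrite divr_ge0 ?mulr_ge0// ltW.
  have E (k : nat) : (s * k.+1%:R / 4 <= y) = (k.+1%:R <= x).
    rewrite /x ler_pdivlMr// ler_pdivrMr//; congr (_ <= _); lra.
  have -> : C1 * y `^ p = (2 * x) `^ (p - 1) * x.
    rewrite /C1 /x -(mulr_powRB1 y0 p0).
    have -> : 2 * (4 * y / s) = (8 / s) * y by field; rewrite gt_eqF.
    have s8 : 0 <= 8 / s by rewrite divr_ge0// ltW.
    rewrite (powRM _ s8 y0).
    by field; rewrite gt_eqF.
  apply: (@le_trans _ _ (\sum_(k < n) (2 * x) `^ (p - 1) * (k.+1%:R <= x)%R%:R)).
    apply: ler_sum => k _; rewrite E; case: (leP k.+1%:R x) => kx.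
      2: by rewrite !mulr0.
    have x20 : 0 <= 2 * x := mulr_ge0 (ler0n R 2) x0.
    rewrite !mulr1; apply: ge0_ler_powR; rewrite ?nnegrE ?subr_ge0//.
    apply: (@le_trans _ _ (2 * k.+1%:R)); last by rewrite ler_pM2l.
    by rewrite -natrM ler_nat mul2n -addnn addSn ltnS leq_addl.
  by rewrite -mulr_sumr ler_wpM2l ?powR_ge0// sum_indic_le.
- rewrite /C2 mulrAC.
  apply: (@le_trans _ _ (\sum_(k < n)
      (2 `^ q * (p / c) `^ p * y `^ q) * r ^+ k)).
    apply: ler_sum => k _.
    have -> : k.+2%:R `^ (p - 1) *
        (2 `^ q * expR (- (k.+1%:R * s * q / 2)) * y `^ q) =
      2 `^ q * y `^ q * (k.+2%:R `^ (p - 1) * expR (- (k.+1%:R * s * q / 2))) by ring.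
    rewrite [leRHS](_ : _ = 2 `^ q * y `^ q * ((p / c) `^ p * r ^+ k)); last by ring.
    rewrite ler_wpM2l ?mulr_ge0 ?powR_ge0//.
    apply: (@le_trans _ _ (k.+2%:R `^ p * expR (- (k.+1%:R * s * q / 2)))).
      by rewrite ler_wpM2r ?expR_ge0// ler_powR ?ler1n// lerBlDr lerDl.
    apply: (@le_trans _ _ ((p / c) `^ p * expR (c * k.+2%:R) *
        expR (- (k.+1%:R * s * q / 2)))).
      by rewrite ler_wpM2r ?expR_ge0// powR_le_expR.
    rewrite -mulrA ler_wpM2l ?powR_ge0// -expRD /r -expRM_natl ler_expR.
    have -> : k.+1%:R * s * q = k.+1%:R * (s * q) by rewrite mulrA.
    have -> : s * q = 8 * c by rewrite /c; field.
    have kc : 0 <= (k%:R : R) * c by rewrite mulr_ge0// ltW.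
    rewrite -(@natr1 R k.+1) -(@natr1 R k). lra.
  rewrite -mulr_sumr ler_wpM2l ?mulr_ge0 ?powR_ge0//.
  have := @geometric_le_lim _ n 1 r ler01 r0; rewrite mul1r gtr0_norm// => /(_ r1).
  apply: le_trans; rewrite /series/= big_mkord; apply: ler_sum => k _.
  by rewrite mul1r.
Qed.

End real_estimates.

(** A sixth root suffices: [exp (1 / 6) <= 6 / 5] because [5 / 6 <= exp (- 1 / 6)], and
    [(6 / 5) ^ 6 < 3]. Hence [log (1 / |h|) > 1] on the punctured ball of radius [1 / 3]. *)
Lemma expR1_lt3 (R : realType) : expR 1 < 3 :> R.
Proof.
have H : expR 6^-1 <= 6 / 5 :> R.
  have := expR_ge1Dx (- 6^-1 : R); rewrite expRN => H.
  have e0 := expR_gt0 (6^-1 : R).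
  by rewrite -[leLHS]invrK -(@invf_div _ 5 6) lef_pV2 ?posrE ?invr_gt0//; lra.
have -> : (1 : R) = 6%:R * 6^-1 by rewrite divff.
rewrite expRM_natl; apply: (@le_lt_trans _ _ ((6 / 5) ^+ 6)).
  by apply: lerXn2r; rewrite ?nnegrE ?expR_ge0.
lra.
Qed.

(** * Logarithmic shells: volume, weight and covering of the ball *)

Section shells.
Context (R : realType) (d : nat).
Local Notation E := 'rV[R]_d.
Local Notation mu := (@lebesgue_rV R d).

Lemma enorm_ge0 (x : E) : 0 <= enorm x.
Proof. exact: sqrtr_ge0. Qed.

Lemma coord_le_enorm (x : E) i : `|x ord0 i| <= enorm x.
Proof.
rewrite /enorm -sqrtr_sqr ler_sqrt ?sumr_ge0//; last by move=> j _; exact: sqr_ge0.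
by rewrite (bigD1 i)//= lerDl sumr_ge0// => j _; exact: sqr_ge0.
Qed.

Lemma measurable_enorm : measurable_fun setT (@enorm R d).
Proof.
apply: (measurableT_comp (@continuous_measurable_fun R (@Num.sqrt R) _)).
  exact: sqrt_continuous.
rewrite /=.
apply: measurable_sum => i.
by apply: measurable_funX; exact: measurable_rV_coord.
Qed.

Definition shell k : set E := [set h | k.+1%:R <= ln (1 / enorm h) < k.+2%:R].

Lemma measurable_shell k : measurable (shell k).
Proof.
have mln : measurable_fun setT (fun h : E => ln (1 / enorm h)).
  apply: (eq_measurable_fun (fun h : E => - ln (enorm h))).
    move=> h _; rewrite div1r.
    have [->|h0] := eqVneq (enorm h) 0; first by rewrite invr0 ln0// oppr0.
    by rewrite lnV// posrE lt_neqAle eq_sym h0 enorm_ge0.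
  apply: measurable_funN.
  by apply: (measurableT_comp (@measurable_ln R)); exact: measurable_enorm.
have -> : shell k = setT `&`
    (fun h : E => ln (1 / enorm h)) @^-1` `[k.+1%:R, k.+2%:R[.
  by rewrite setTI; apply/seteqP; split => x; rewrite /shell/= in_itv.
exact: mln.
Qed.

(** By the conventions [1 / 0 = 0] and [ln 0 = 0], the origin has logarithm 0, below every
    [k + 1]. *)
Lemma shell_enorm_gt0 k h : shell k h -> 0 < enorm h.
Proof.
move=> /andP[kh _]; rewrite lt_neqAle enorm_ge0 andbT eq_sym; apply/eqP => h0.
by move: kh; rewrite h0 invr0 mulr0 ln0// lern0.
Qed.

Lemma shell_lnE k h : shell k h -> enorm h = expR (- ln (1 / enorm h)).
Proof.
move=> /shell_enorm_gt0 h0.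
by rewrite div1r lnV// opprK lnK.
Qed.

(** The Euclidean norm bounds each coordinate, so the shell lies in a cube of half-side
    [exp (- (k + 1))]. *)
Lemma lebesgue_shell k : (mu (shell k) <= ((expR (- k.+1%:R) *+ 2) ^+ d)%:E)%E.
Proof.
rewrite -lebesgue_rV_box ?expR_ge0//; apply: le_measure; rewrite ?inE.
- exact: measurable_shell.
- exact: measurable_box.
- move=> h kh i; apply: (le_trans (coord_le_enorm h i)).
  rewrite (shell_lnE kh) ler_expR lerN2; by case/andP: kh.
Qed.

Lemma log_weight_ge0 p (h : E) : 0 <= log_weight p h.
Proof. by rewrite /log_weight divr_ge0// powR_ge0. Qed.

(** Since [1 - p <= 0], the weight is a nonnegative power of the logarithm, so the upper end [k + 2]
    of the shell bounds both factors. *)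
Lemma shell_weight_le p k h : 1 <= p -> shell k h ->
  log_weight p h / enorm h ^+ d <= expR k.+2%:R ^+ d * k.+2%:R `^ (p - 1).
Proof.
move=> p1 kh; have /andP[k1 /ltW k2] := kh.
have L0 : 0 <= ln (1 / enorm h) by apply: le_trans k1.
rewrite mulrC; apply: ler_pM.
- by rewrite invr_ge0 exprn_ge0// enorm_ge0.
- exact: log_weight_ge0.
- rewrite {1}(shell_lnE kh) expRN -exprVn invrK.
  by apply: lerXn2r; rewrite ?nnegrE ?expR_ge0// ler_expR.
- rewrite /log_weight div1r -powRN opprB.
  by apply: ge0_ler_powR; rewrite ?nnegrE// subr_ge0.
Qed.

Lemma eball_shell h : eball (1 / 3) h -> enorm h != 0 -> exists k, shell k h.
Proof.
rewrite /eball/= => h3 h0.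
have {}h0 : 0 < enorm h by rewrite lt_neqAle eq_sym h0 enorm_ge0.
have L1 : 1 < ln (1 / enorm h).
  rewrite -ltr_expR lnK ?posrE ?divr_gt0//.
  have e3 : expR 1 < 3 :> R by exact: expR1_lt3.
  by apply: (lt_trans e3); rewrite ltr_pdivlMr// mulrC -ltr_pdivlMr.
(* Shell [k] starts at logarithm [k + 1], so [k] is the integer part minus one; that part is at
   least 1 because the logarithm exceeds 1. *)
exists (Num.truncn (ln (1 / enorm h))).-1.
have L0 : 0 <= ln (1 / enorm h) by apply: le_trans (ltW L1).
have /andP[H1 H2] := truncn_itv L0.
have : (0 < Num.truncn (ln (1 / enorm h)))%N by rewrite truncn_gt0 ltW.
case: (Num.truncn _) H1 H2 => // n H1 H2 _ /=.
by rewrite /shell/= H1 H2.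
Qed.

End shells.

(** * The integral inequality for truncated differences *)

Lemma nneseries_le_bound (R : realType) (u : nat -> \bar R) (M : \bar R) :
  (forall k, 0 <= u k)%E -> (forall n, \sum_(k < n) u k <= M)%E ->
  (\sum_(k <oo) u k <= M)%E.
Proof.
move=> u0 uM; apply: lime_le; first exact: is_cvg_nneseries.
by apply: nearW => n; rewrite big_mkord.
Qed.

Section main_estimate.
Context (R : realType) (d : nat).
Local Notation E := 'rV[R]_d.
Local Notation mu := (@lebesgue_rV R d).
Implicit Types (f g : E -> R) (p s q : R).

(** Translation invariance keeps the exceptional set null. This lets almost everywhere facts be used
    at [x] and [x + h] simultaneously. *)
Lemma ae_rV_translation (P : E -> Prop) (h : E) :
  {ae mu, forall x, P x} -> {ae mu, forall x, P (x + h)}.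
Proof.
move=> [N [mN N0 PN]]; exists ((fun x => x + h) @^-1` N); split.
- by rewrite -[X in measurable X]setTI; exact: measurable_rV_translation.
- by rewrite lebesgue_rV_translation.
- by move=> x /= Px; exact: PN.
Qed.

(** The pointwise bound gives one term at [x] and one at [x + h], with equal integrals, whence the
    factor 2. The majorant uses the Borel function [g'], for which additivity and translation are
    available, and its absolute value because [g'] may be negative on a null set. *)
Lemma shell_difference_le p s q k f g g' (h : E) :
  1 <= p -> 0 < s -> 0 < q -> shell k h ->
  (forall x, 0 < g x) -> measurable_fun setT g' ->
  {ae mu, forall x, g x = g' x} -> N_ineq s f g ->
  (\int[mu]_x (Num.min 1 (`|f (x + h)%R - f x| `^ q) / enorm h ^+ d
      * log_weight p h)%:E
    <= (2 * (expR k.+2%:R ^+ d * k.+2%:R `^ (p - 1)))%:E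
       * \int[mu]_x (shell_majorant s q k `|g' x|)%:E)%E.
Proof.
move=> p1 s0 q0 kh g0 mg' gg' fg.
have mT : measurable_fun setT (fun x => (shell_majorant s q k `|g' x|)%:E).
  apply/measurable_EFinP; apply: measurableT_comp.
    exact: measurable_shell_majorant.
  exact: measurableT_comp.
have T0 x : (0 <= (shell_majorant s q k `|g' x|)%:E)%E.
  by rewrite lee_fin shell_majorant_ge0.
set W := expR _ ^+ d * _.
have W0 : 0 <= W by rewrite mulr_ge0 ?powR_ge0 ?exprn_ge0 ?expR_ge0.
have h0 := shell_enorm_gt0 kh.
have mTh : measurable_fun setT
    (fun x : E => (shell_majorant s q k `|g' (x + h)%R|)%:E).
  exact: (measurableT_comp mT (measurable_rV_translation h)).
apply: (@le_trans _ _ (\int[mu]_x (W%:E *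
    ((shell_majorant s q k `|g' x|)%:E +
     (shell_majorant s q k `|g' (x + h)%R|)%:E)))%E).
  apply: ae_ge0_le_lower_integral.
  - move=> x; rewrite lee_fin; apply: mulr_ge0; last exact: log_weight_ge0.
    by apply: divr_ge0; rewrite ?exprn_ge0 ?enorm_ge0// le_min ler01 powR_ge0.
  - move=> x; rewrite -EFinD -EFinM lee_fin mulr_ge0// addr_ge0//;
      exact: shell_majorant_ge0.
  - have := ae_rV_translation h gg'; move: gg'; apply: filterS2 => x <- <-.
    rewrite -EFinD -EFinM lee_fin -mulrA [_^-1 * _]mulrC [leRHS]mulrC.
    apply: ler_pM.
    + by rewrite le_min ler01 powR_ge0.
    + by rewrite divr_ge0 ?log_weight_ge0 ?exprn_ge0 ?enorm_ge0.
    + apply: (min_powR_le_shell_majorant s0 q0 h0) => //; first by case/andP: kh.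
      rewrite (gtr0_norm (g0 x)) (gtr0_norm (g0 (x + h))).
      by have := fg (x + h) x; rewrite [x + h - x]addrC addKr [g (x + h) + _]addrC.
    + exact: shell_weight_le.
rewrite ge0_integralZl_EFin//; last 2 first.
- by move=> x _; rewrite adde_ge0 ?lee_fin ?shell_majorant_ge0.
- exact: emeasurable_funD.
rewrite ge0_integralD// (integral_rV_translation _ mT)//.
set J := (\int[mu]_x _)%E.
move: W {W0} => W.
by rewrite [(2 * W)%R]mulrC EFinM -muleA [X in (_ <= _ * X)%E]mule_natl mule2n.
Qed.

Lemma integral_powR_Lnorm_le q g g' : 0 < q -> {ae mu, forall x, g x = g' x} ->
  (\int[mu]_x (`|g' x| `^ q)%:E <= 'N[mu]_(q%:E)[EFin \o g] `^ q)%E.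
Proof.
move=> q0 gg'; rewrite poweR_Lnorm ?gt_eqF//.
apply: ae_ge0_le_lower_integral => [x|x|]; rewrite ?lee_fin ?powR_ge0//.
by move: gg'; apply: filterS => x /= ->.
Qed.

Lemma truncated_difference_le p s q : (0 < d)%N -> 1 <= p -> 0 < s -> 0 < q ->
  exists2 C : R, 0 < C & forall f g,
    (forall x, 0 < g x) -> lebesgue_measurable g -> N_ineq s f g ->
    (\int[mu]_(h in eball (1 / 3)%R) \int[mu]_x
        (Num.min 1 (`|f (x + h)%R - f x| `^ q) / enorm h ^+ d
          * log_weight p h)%:E
     <= C%:E * ('N[mu]_(p%:E)[EFin \o g] `^ p + 'N[mu]_(q%:E)[EFin \o g] `^ q))%E.
Proof.
move=> d0 p1 s0 q0; have p0 : 0 < p by exact: lt_le_trans p1.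
have [C C0 HC] := sum_shell_majorant_le p1 s0 q0.
(* The factor 2 counts the two translates; the rest is the weight bound [exp (k + 2) ^ d] times the
   volume bound [(2 * exp (- (k + 1))) ^ d]. *)
pose K : R := 2 * (2 * expR 1) ^+ d.
have K0 : 0 < K by rewrite mulr_gt0 ?exprn_gt0 ?mulr_gt0 ?expR_gt0.
exists (K * C); first exact: mulr_gt0.
move=> f g g0 [g' mg' gg'] fg.
pose J k := (\int[mu]_x (shell_majorant s q k `|g' x|)%:E)%E.
have mT k : measurable_fun setT (fun x => (shell_majorant s q k `|g' x|)%:E).
  apply/measurable_EFinP; apply: measurableT_comp.
    exact: measurable_shell_majorant.
  exact: measurableT_comp.
have J0 k : (0 <= J k)%E.
  by apply: integral_ge0 => x _; rewrite lee_fin shell_majorant_ge0.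
pose W k : R := 2 * (expR k.+2%:R ^+ d * k.+2%:R `^ (p - 1)).
have W0 k : 0 <= W k.
  by rewrite !mulr_ge0 ?powR_ge0 ?exprn_ge0 ?expR_ge0.
have WJ0 k : (0 <= (W k)%:E * J k)%E by rewrite mule_ge0 ?lee_fin.
have term0 k (h : E) : (0 <= (W k)%:E * J k * (\1_(shell k) h)%:E)%E.
  by rewrite mule_ge0// lee_fin.
(* No measurability in [h] of the inner integral is assumed: it is majorized by a series whose terms
   are constant on each shell, which can be integrated term by term. *)
apply: (@le_trans _ _ (\int[mu]_h \sum_(k <oo)
    ((W k)%:E * J k * (\1_(@shell R d k) h)%:E))%E).
  have F0 h x : (0 <= (Num.min 1 (`|f (x + h)%R - f x| `^ q) / enorm h ^+ d
          * log_weight p h)%:E)%E.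
    rewrite lee_fin; apply: mulr_ge0; last exact: log_weight_ge0.
    by apply: divr_ge0; rewrite ?exprn_ge0 ?enorm_ge0// le_min ler01 powR_ge0.
  apply: ge0_le_lower_integral => [h|h|h h3].
  - exact: integral_ge0.
  - exact: nneseries_ge0.
  (* The origin lies in no shell, but there [|h| ^ d = 0] since [d >= 1], and the inverse of 0 is 0,
     so the integrand vanishes. *)
  - have [h0|/(eball_shell h3)[k kh]] := eqVneq (enorm h) 0.
      rewrite (eq_integral (cst 0%E)) ?integral0; last first.
        by move=> x _; rewrite h0 expr0n gtn_eqF// invr0 mulr0 mul0r.
      exact: nneseries_ge0.
    apply: (le_trans (shell_difference_le p1 s0 q0 kh g0 mg' gg' fg)).
    (* The partial sum of [k + 1] terms ends with the term of the shell containing [h]. *)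
    apply: le_trans (nneseries_lim_ge k.+1 _); last by [].
    rewrite big_mkord big_ord_recr/= indicE mem_set// mule1 leeDr// sume_ge0//.
rewrite integral_nneseries//; last first.
  move=> k; apply: emeasurable_funM => //.
  by apply/measurable_EFinP; apply: measurable_indic; exact: measurable_shell.
apply: (@le_trans _ _ (\sum_(k <oo) (K%:E *
    \int[mu]_x (k.+2%:R `^ (p - 1) * shell_majorant s q k `|g' x|)%:E))%E).
  apply: lee_nneseries => [k _ _|k _].
    by apply: integral_ge0 => h _.
  have mS := @measurable_shell R d k.
  rewrite ge0_integralZl//; last by apply/measurable_EFinP; exact: measurable_indic.
  rewrite integral_indic// setIT.
  under [X in (_ <= _ * X)%E]eq_integral do rewrite EFinM.
  rewrite ge0_integralZl_EFin ?powR_ge0//; last first.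
    by move=> x _; rewrite lee_fin shell_majorant_ge0.
  rewrite -/(J k) [leLHS]muleAC muleA; apply: lee_wpmul2r => //.
  apply: le_trans (lee_wpmul2l _ (@lebesgue_shell R d k)) _.
    by rewrite lee_fin.
  have HA : expR k.+2%:R ^+ d * (expR (- k.+1%:R) *+ 2) ^+ d =
      (2 * expR 1) ^+ d :> R.
    rewrite -exprMn mulrnAr -expRD -mulr_natl; congr ((_ * expR _) ^+ _).
    rewrite -(@natr1 R k.+1); ring.
  rewrite -EFinM lee_fin /W /K -HA le_eqVlt; apply/orP; left; apply/eqP.
  by rewrite !mulrA; exact: mulrAC.
rewrite nneseriesZl; last first.
  move=> k _; apply: integral_ge0 => x _.
  by rewrite lee_fin mulr_ge0 ?powR_ge0 ?shell_majorant_ge0.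
rewrite (EFinM K C) -muleA; apply: lee_wpmul2l; first by rewrite lee_fin ltW.
have mkT k : measurable_fun setT
    (fun x => (k.+2%:R `^ (p - 1) * shell_majorant s q k `|g' x|)%:E).
  by under eq_fun do rewrite EFinM; exact: emeasurable_funM.
have mg q1 : measurable_fun setT (fun x => (`|g' x| `^ q1)%:E).
  apply/measurable_EFinP; apply: (measurableT_comp (measurable_powR _)).
  exact: measurableT_comp.
(* The sum goes back inside the integral, where for each [x] its partial sums have a bound
   independent of the number of terms. *)
rewrite -integral_nneseries//; last first.
  by move=> k x _; rewrite lee_fin mulr_ge0 ?powR_ge0 ?shell_majorant_ge0.
apply: (@le_trans _ _ (\int[mu]_x (C%:E *
    ((`|g' x| `^ p)%:E + (`|g' x| `^ q)%:E)))%E).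
  apply: ae_ge0_le_lower_integral => [x|x|].
  - apply: nneseries_ge0 => k _ _.
    by rewrite lee_fin mulr_ge0 ?powR_ge0 ?shell_majorant_ge0.
  - by rewrite -EFinD -EFinM lee_fin mulr_ge0 ?addr_ge0 ?powR_ge0// ltW.
  - apply: nearW => x; apply: nneseries_le_bound => [k|n].
      by rewrite lee_fin mulr_ge0 ?powR_ge0 ?shell_majorant_ge0.
    by rewrite sumEFin -EFinD -EFinM lee_fin HC.
rewrite ge0_integralZl_EFin//; last 3 first.
- by move=> x _; rewrite -EFinD lee_fin addr_ge0 ?powR_ge0.
- exact: emeasurable_funD.
- exact: ltW.
apply: lee_wpmul2l; first by rewrite lee_fin ltW.
rewrite ge0_integralD//; [|by move=> x _; rewrite lee_fin powR_ge0..].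
by apply: leeD; exact: integral_powR_Lnorm_le.
Qed.
End main_estimate.

(** * Removing the truncation for bounded functions, and the immersions *)

Section immersion.
Context (R : realType) (d : nat).
Local Notation E := 'rV[R]_d.
Local Notation mu := (@lebesgue_rV R d).
Implicit Types (f g : E -> R) (p s q : R).

Lemma Lnorm_y_le_ae f M : ('N[mu]_+oo[EFin \o f] <= M%:E)%E ->
  {ae mu, forall x, `|f x| <= M}.
Proof.
rewrite unlock; case: ifPn => [_ /ess_supP|].
  by apply: filterS => x /=; rewrite lee_fin.
(* In this case the whole space is null, so every property holds almost everywhere. *)
rewrite -leNgt => mu0 _; exists setT; split => //.
by apply/eqP; rewrite eq_le mu0 measure_ge0.
Qed.

Lemma powR_le_truncated p y K : 0 <= p -> 0 <= y <= K -> 1 <= K ->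
  y `^ p <= K `^ p * Num.min 1 (y `^ p).
Proof.
move=> p0 /andP[y0 yK] K1.
have K0 : 0 <= K by exact: le_trans K1.
have K1p : 1 <= K `^ p.
  have : 1 `^ p <= K `^ p by apply: ge0_ler_powR; rewrite ?nnegrE.
  by rewrite powR1.
case: (leP 1 (y `^ p)) => _; last by rewrite ler_peMl// powR_ge0.
by rewrite mulr1; apply: ge0_ler_powR; rewrite ?nnegrE.
Qed.

Lemma ge0_le_poweR r (x y : \bar R) : 0 <= r -> (0 <= x)%E -> (x <= y)%E ->
  (x `^ r <= y `^ r)%E.
Proof.
move=> r0 x0 xy; apply: gt0_ler_poweR => //; rewrite in_itv/= leey andbT//.
exact: le_trans xy.
Qed.

(** For [q = p] both terms of the truncated inequality are the same power of the norm, which gives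
    the constant [(2 * C) ^ (1 / p)]. Almost everywhere [|f (x + h) - f x| <= 2 * M], so removing
    the truncation costs a factor [K ^ p] with [K = max 1 (2 * M)]. *)
Lemma X_func_le_Lnorm p s : (0 < d)%N -> 1 <= p -> 0 < s ->
  exists2 C : R, 0 < C & forall f g M, N_admissible s p f g ->
    ('N[mu]_+oo[EFin \o f] <= M%:E)%E ->
    (X_func p f <= (Num.max 1 (2 * M) * C)%:E * 'N[mu]_(p%:E)[EFin \o g])%E.
Proof.
move=> d0 p1 s0; have p0 : 0 < p by exact: lt_le_trans p1.
have [C C0 HC] := truncated_difference_le d0 p1 s0 p0.
exists ((2 * C) `^ p^-1); first by rewrite powR_gt0// mulr_gt0.
move=> f g M [g0 [mg _] fg] /Lnorm_y_le_ae fM.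
set K := Num.max 1 (2 * M).
have K1 : 1 <= K by rewrite /K le_max lexx.
have KM : 2 * M <= K by rewrite /K le_max lexx orbT.
have K0 : 0 < K by exact: lt_le_trans K1.
have Kp0 : 0 < K `^ p by exact: powR_gt0.
have := HC f g g0 mg fg.
set I := (X in (X <= _)%E -> _); set N := 'N[mu]_(p%:E)[_]%E => IN.
have N0 : (0 <= N)%E by exact: Lnorm_ge0.
have w0 (h : E) (u : R) : 0 <= u -> 0 <= u / enorm h ^+ d * log_weight p h.
  by move=> u0; rewrite mulr_ge0 ?log_weight_ge0// divr_ge0 ?exprn_ge0 ?enorm_ge0.
have t0 (h x : E) : 0 <= Num.min 1 (`|f (x + h) - f x| `^ p).
  by rewrite le_min ler01 powR_ge0.
have XI : (\int[mu]_(h in eball (1 / 3)%R) \int[mu]_x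
      (`|f (x + h)%R - f x| `^ p / enorm h ^+ d * log_weight p h)%:E
   <= (K `^ p)%:E * I)%E.
  apply: le_trans (ge0_lower_integralZl_le _ _ _ _) => //; last first.
    by move=> h; apply: integral_ge0 => x _; rewrite lee_fin w0.
  rewrite [leRHS]integral_mkcond; apply: ge0_le_lower_integral => [h|h|h hB].
  - by apply: integral_ge0 => x _; rewrite lee_fin w0 ?powR_ge0.
  - rewrite patchE; case: ifP => // _; rewrite mule_ge0 ?lee_fin ?(ltW Kp0)//.
    by apply: integral_ge0 => x _; rewrite lee_fin w0.
  - rewrite patchE mem_set//.
    apply: le_trans (ge0_lower_integralZl_le _ _ _ _) => //; last first.
      by move=> x; rewrite lee_fin w0.
    apply: ae_ge0_le_lower_integral => [x|x|].
    + by rewrite lee_fin w0 ?powR_ge0.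
    + by rewrite mule_ge0 ?lee_fin ?w0// ltW.
    have := ae_rV_translation h fM; move: fM; apply: filterS2 => x fx fxh.
    rewrite -EFinM lee_fin 2!(mulrA (K `^ p)).
    apply: ler_wpM2r; first exact: log_weight_ge0.
    apply: ler_wpM2r; first by rewrite invr_ge0 exprn_ge0 ?enorm_ge0.
    apply: powR_le_truncated => //; first exact: ltW.
    rewrite normr_ge0 (le_trans (ler_normB _ _))//; lra.
rewrite /X_func.
apply: (@le_trans _ _ (((K `^ p)%:E * ((2 * C)%:E * N `^ p)) `^ p^-1)%E).
  apply: ge0_le_poweR; first by rewrite invr_ge0 ltW.
    apply: integral_ge0 => h _; apply: integral_ge0 => x _.
    by rewrite lee_fin w0 ?powR_ge0.
  apply: (le_trans XI); apply: lee_wpmul2l; first by rewrite lee_fin ltW.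
  apply: (le_trans IN); rewrite [(2 * C)%R]mulrC EFinM -muleA.
  by rewrite [X in (_ <= _ * X)%E]mule_natl mule2n.
have pV : p * p^-1 = 1 by rewrite divff// gt_eqF.
rewrite !poweRM ?mule_ge0 ?lee_fin ?powR_ge0 ?poweR_ge0 ?mulr_ge0 ?(ltW C0)//.
rewrite -poweRrM pV poweRe1// !poweR_EFin -powRrM pV powRr1 ?(ltW K0)//.
by rewrite muleA -EFinM.
Qed.

Lemma N_func_ge0 s p f : (0 <= N_func s p f)%E.
Proof. by apply: le_ereal_inf_tmp => _ [g _ <-]; exact: Lnorm_ge0. Qed.

(** The infimum need not be attained, so the bound is in terms of any [a] strictly above it: some
    admissible [g] has norm below [a]. *)
Lemma X_func_le p s : (0 < d)%N -> 1 <= p -> 0 < s ->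
  exists2 C : R, 0 < C & forall f M a,
    ('N[mu]_+oo[EFin \o f] <= M%:E)%E -> (N_func s p f < a%:E)%E ->
    (X_func p f <= (Num.max 1 (2 * M) * C * a)%:E)%E.
Proof.
move=> d0 p1 s0; have [C C0 HC] := X_func_le_Lnorm d0 p1 s0.
exists C => // f M a fM /ereal_inf_lt[_ [g fg <-] ga].
apply: (le_trans (HC _ _ _ fg fM)); rewrite [leRHS]EFinM.
by apply: lee_wpmul2l (ltW ga); rewrite lee_fin mulr_ge0 ?(ltW C0)// le_max ler01.
Qed.

(** The factor 2 is enough because [m ^ p + m ^ p <= (2 * m) ^ p] when [p >= 1]. *)
Lemma X_norm_le p f m : 1 <= p ->
  ('N[mu]_(p%:E)[EFin \o f] <= m%:E)%E -> (X_func p f <= m%:E)%E ->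
  (X_norm p f <= (2 * m)%:E)%E.
Proof.
move=> p1 fm Xm; have p0 : 0 < p by exact: lt_le_trans p1.
have X0 : (0 <= X_func p f)%E by exact: poweR_ge0.
have N0 : (0 <= 'N[mu]_(p%:E)[EFin \o f])%E by exact: Lnorm_ge0.
have m0 : 0 <= m by rewrite -lee_fin (le_trans N0).
rewrite /X_norm; apply: (@le_trans _ _ (((2 * m) `^ p)%:E `^ p^-1)%E); last first.
  by rewrite poweR_EFin -powRrM divff ?gt_eqF// powRr1// mulr_ge0.
apply: ge0_le_poweR; [by rewrite invr_ge0 ltW|by rewrite adde_ge0 ?poweR_ge0|].
apply: (@le_trans _ _ (m%:E `^ p + m%:E `^ p)%E).
  by apply: leeD; apply: ge0_le_poweR => //; exact: ltW.
rewrite !poweR_EFin -EFinD lee_fin powRM// -mulr2n -[leLHS]mulr_natl.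
by rewrite ler_wpM2r ?powR_ge0// le1r_powR// ler1n.
Qed.

End immersion.

(** Nonzero constants are bounded elements of [N_space] outside [X_space], so the immersion takes
    two forms: for the functional [X_func] alone, and, once the source is intersected with
    [Lp p%:E], for the full norm. *)
Theorem theorem3p8 (R : realType) (d : nat) (d_ge1 : (1 <= d)%N)
    (p s : R) (p_ge1 : 1 <= p) (s_gt0 : 0 < s) (s_le1 : s <= 1) :
  (forall q : R, 0 < q ->
    exists2 C : R, 0 < C &
    forall f g : 'rV[R]_d -> R,
      Lp_loc p f -> (forall x, 0 < g x) -> Lp p%:E g -> N_ineq s f g ->
      (\int[lebesgue_rV d]_(h in eball (1 / 3)%R) \int[lebesgue_rV d]_x
          (Num.min 1 (`|f (x + h) - f x| `^ q) / enorm h ^+ d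
            * log_weight p h)%:E
       <= C%:E * ('N[lebesgue_rV d]_(p%:E)[EFin \o g] `^ p
                  + 'N[lebesgue_rV d]_(q%:E)[EFin \o g] `^ q))%E)
  /\
  continuous_immersion
    (N_space s p `&` @Lp R d +oo%E)
    (fun f => (N_func s p f + 'N[lebesgue_rV d]_+oo[EFin \o f])%E)
    [set f | (X_func p f < +oo)%E] (X_func p)
  /\
  continuous_immersion
    (N_space s p `&` @Lp R d +oo%E `&` Lp p%:E)
    (fun f => (N_func s p f + 'N[lebesgue_rV d]_+oo[EFin \o f]
               + 'N[lebesgue_rV d]_(p%:E)[EFin \o f])%E)
    (X_space p) (X_norm p).
Proof.
split.
  move=> q q0; have [C C0 HC] := truncated_difference_le d_ge1 p_ge1 s_gt0 q0.
  by exists C => // f g _ g0 [mg _] fg; exact: HC.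
have [C C0 HC] := X_func_le d_ge1 p_ge1 s_gt0.
have Ny0 (f : 'rV[R]_d -> R) : (0 <= 'N[lebesgue_rV d]_+oo[EFin \o f])%E.
  exact: Lnorm_ge0.
have Np0 (f : 'rV[R]_d -> R) : (0 <= 'N[lebesgue_rV d]_(p%:E)[EFin \o f])%E.
  exact: Lnorm_ge0.
have Nf0 (f : 'rV[R]_d -> R) := N_func_ge0 s p f.
have sub (f : 'rV[R]_d -> R) : N_space s p f -> Lp +oo%E f -> (X_func p f < +oo)%E.
  move=> [_ [g fg]] [_ fy]; have [_ [_ gp] _] := fg.
  have fyfin : 'N[lebesgue_rV d]_+oo[EFin \o f]%E \is a fin_num.
    by rewrite ge0_fin_numE.
  have gfin : 'N[lebesgue_rV d]_(p%:E)[EFin \o g]%E \is a fin_num.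
    by rewrite ge0_fin_numE.
  apply: le_lt_trans (ltry _).
  (* Adding 1 to the norm of [g] gives a number strictly above the infimum. *)
  apply: (HC f (fine 'N[lebesgue_rV d]_+oo[EFin \o f]%E)
    (fine 'N[lebesgue_rV d]_(p%:E)[EFin \o g]%E + 1)); first by rewrite fineK.
  apply: (@le_lt_trans _ _ 'N[lebesgue_rV d]_(p%:E)[EFin \o g]%E).
    by apply: ereal_inf_lbound; exists g.
  by rewrite -[ltLHS](fineK gfin) lte_fin ltrDl ltr01.
have split_lt (x y z : \bar R) : (0 <= x)%E -> (0 <= y)%E -> (x + y < z)%E ->
    (x < z)%E /\ (y < z)%E.
  move=> x0 y0 xyz; split; apply: le_lt_trans xyz; first exact: leeDl.
  exact: leeDr.
have split_le (x y z : \bar R) : (0 <= x)%E -> (0 <= y)%E -> (x + y <= z)%E ->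
    (x <= z)%E /\ (y <= z)%E.
  move=> x0 y0 xyz; split; apply: le_trans xyz; first exact: leeDl.
  exact: leeDr.
(* Quantified over all [f] so as to apply to the difference [f \- f0]. The quantity
   [(C + 1) * delta] dominates both [C * delta] and, for the full norm, the bound [delta] on the
   norm in [Lp p%:E]; the factor 2 is that of [X_norm_le]. *)
have small (e : R) : 0 < e -> exists2 delta : R,
    0 < delta & 2 * ((C + 1) * delta) < e /\ forall f : 'rV[R]_d -> R,
      (N_func s p f + 'N[lebesgue_rV d]_+oo[EFin \o f] < delta%:E)%E ->
      (X_func p f <= ((C + 1) * delta)%:E)%E.
  (* The bound [delta <= 1 / 2] reduces [max 1 (2 * delta)] to 1; the other gives
     [2 * (C + 1) * delta <= e / 2]. *)
  move=> e0; pose delta := Num.min 2^-1 (e / (4 * (C + 1))).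
  have C1 : 0 < C + 1 by rewrite addr_gt0.
  have delta0 : 0 < delta by rewrite lt_min invr_gt0 ltr0n divr_gt0// mulr_gt0.
  exists delta => //; split.
    have : delta <= e / (4 * (C + 1)) by rewrite ge_min lexx orbT.
    rewrite ler_pdivlMr ?mulr_gt0//; lra.
  move=> f /(split_lt _ _ _ (Nf0 f) (Ny0 f))[fN fy].
  apply: (le_trans (HC _ _ _ (ltW fy) fN)); rewrite lee_fin max_l; last first.
    have : delta <= 2^-1 by rewrite ge_min lexx.
    lra.
  by rewrite mul1r ler_pM2r// lerDl.
have bounded (A : R) : exists B : R, forall f : 'rV[R]_d -> R,
      (N_func s p f + 'N[lebesgue_rV d]_+oo[EFin \o f] <= A%:E)%E ->
      (X_func p f <= B%:E)%E.
  (* [X_func_le] asks for a number strictly above the infimum, hence [A + 1]. *)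
  exists (Num.max 1 (2 * A) * C * (A + 1)) => f.
  move=> /(split_le _ _ _ (Nf0 f) (Ny0 f))[fN fy]; apply: HC => //.
  by apply: (le_lt_trans fN); rewrite lte_fin ltrDl.
split; split.
- by move=> f [fN fy]; exact: sub.
- move=> f0 _ e /small[delta delta0 [de H]]; exists delta => // f _ /H Xf.
  apply: (le_lt_trans Xf); rewrite lte_fin; apply: le_lt_trans de.
  by rewrite ler_peMl ?mulr_ge0 ?ler1n// ?addr_ge0// ltW.
- by move=> A; have [B HB] := bounded A; exists B => f _; exact: HB.
- by move=> f [[fN fy] fp]; split => //; exact: sub.
- move=> f0 _ e /small[delta delta0 [de H]]; exists delta => // f _ fd.
  have [fV fp] := split_lt _ _ _ (adde_ge0 (Nf0 _) (Ny0 _)) (Np0 _) fd.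
  apply: (@le_lt_trans _ _ (2 * ((C + 1) * delta))%:E); last by rewrite lte_fin.
  apply: X_norm_le => //; last exact: H.
  by apply: (le_trans (ltW fp)); rewrite lee_fin ler_peMl ?lerDr// ltW.
- move=> A; have [B HB] := bounded A; exists (2 * Num.max A B) => f _ fA.
  have [fV fp] := split_le _ _ _ (adde_ge0 (Nf0 _) (Ny0 _)) (Np0 _) fA.
  apply: X_norm_le => //.
    by apply: (le_trans fp); rewrite lee_fin le_max lexx.
  by apply: (le_trans (HB _ fV)); rewrite lee_fin le_max lexx orbT.
Qed.
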